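(* For every admissible $(z,z')$, the spectral $z$-measure $P_{zz'}$ is concentrated on the face $\Omega_0=\{(\alpha,\beta,\gamma)\in\Omega:\gamma=0\}$ of the Thoma simplex, i.e. $P_{zz'}(\Omega_0)=1$. Equivalently, the first controlling measure $\sigma^{(zz')}_1$ has no atom at $0$.
   Context: Thoma simplex $\Omega$: triples $\omega=(\alpha,\beta,\gamma)$ with $\alpha_1\ge\alpha_2\ge\dots\ge0$, $\beta_1\ge\dots\ge0$, $\gamma\ge0$, $\sum(\alpha_i+\beta_i)+\gamma=1$, with the weakest topology making all $\alpha_i,\beta_i$ continuous. Extended power sums $\tilde p_1\equiv1$, $\tilde p_n=\sum\alpha_i^n+(-1)^{n-1}\sum\beta_i^n$ ($n\ge2$); $\tilde s_\lambda$ is the Schur function $s_\lambda$ written as a polynomial in power sums $p_n$ with $p_n$ replaced by $\tilde p_n$. $\dim\lambda$ = number of standard Young tableaux of shape $\lambda$. Admissible parameters: either $z'=\bar z$, $z\notin\mathbb Z$, or $z,z'$ real in a common interval $(m,m+1)$, $m\in\mathbb Z$; $t=zz'$. $M_{zz'}(\lambda)=\frac{\prod_{(i,j)\in\lambda}(z+j-i)(z'+j-i)}{(t)_{|\lambda|}}\frac{(\dim\lambda)^2}{|\lambda|!}$, and $P_{zz'}$ is the unique Borel probability measure on $\Omega$ with $M_{zz'}(\lambda)/\dim\lambda=\int\tilde s_\lambda\,dP_{zz'}$ for all $\lambda$. $\sigma^{(zz')}_1=\int_\Omega\nu^{(\omega)}P_{zz'}(d\omega)$ with $\nu^{(\omega)}=\sum\alpha_i\delta(\alpha_i)+\sum\beta_i\delta(-\beta_i)+\gamma\delta(0)$.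 *)

(* Defs.v *)
From HB Require Import structures.
From mathcomp Require Import all_boot all_order all_algebra.
From mathcomp Require Import all_classical all_reals all_analysis.
From mathcomp Require Import complex.

Set Implicit Arguments.
Unset Strict Implicit.
Unset Printing Implicit Defensive.
Import Order.TTheory GRing.Theory Num.Theory.
Import numFieldNormedType.Exports.
Local Open Scope classical_set_scope.
Local Open Scope ring_scope.

Definition is_partition (lam : seq nat) : bool :=
  sorted geq lam && all (fun x => 0 < x)%N lam.

Definition psize (lam : seq nat) : nat := sumn lam.

Definition box_pred (lam : seq nat) (p : 'I_(size lam) * 'I_(head 0%N lam)) : bool :=
  (p.2 < nth 0%N lam p.1)%N.

Definition box (lam : seq nat) := {p : 'I_(size lam) * 'I_(head 0%N lam) | @box_pred lam p}.

(* standard Young tableau: an injective filling of the boxes with 0..|lam|-1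
   (hence a bijection onto {0..|lam|-1}), increasing along rows and columns *)
Definition is_SYT (lam : seq nat) (T : {ffun box lam -> 'I_(psize lam)}) : bool :=
  injectiveb T &&
  [forall b1 : box lam, forall b2 : box lam,
     (((val b1).1 == (val b2).1) && ((val b1).2 < (val b2).2)%N ==> (T b1 < T b2)%N) &&
     (((val b1).2 == (val b2).2) && ((val b1).1 < (val b2).1)%N ==> (T b1 < T b2)%N)].

Definition dimY (lam : seq nat) : nat := #|[set T | @is_SYT lam T]|.

Definition thoma_cond (R : realType) (w : (nat -> R) * (nat -> R) * R) : Prop :=
  let: (a, b, g) := w in
  (forall i, 0 <= a i) /\ (forall i, a i.+1 <= a i) /\
  (forall i, 0 <= b i) /\ (forall i, b i.+1 <= b i) /\
  0 <= g /\
  ((fun n => \sum_(i < n) (a i + b i)) @ \oo --> 1 - g).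

Definition thoma_pt (R : realType) : (nat -> R) * (nat -> R) * R :=
  (fun _ => 0, fun _ => 0, 1).

Lemma thoma_pt_cond (R : realType) : thoma_cond (thoma_pt R).
Proof.
rewrite /thoma_pt /=; do 5 (split; first by move=> *; rewrite ?lexx ?ler01).
under eq_fun do rewrite big1 ?addr0 //.
by rewrite subrr; exact: cvg_cst.
Qed.

Definition Thoma (R : realType) := {w : (nat -> R) * (nat -> R) * R | thoma_cond w}.

HB.instance Definition _ (R : realType) := gen_eqMixin (Thoma R).
HB.instance Definition _ (R : realType) := gen_choiceMixin (Thoma R).
HB.instance Definition _ (R : realType) :=
  isPointed.Build (Thoma R) (exist _ (thoma_pt R) (@thoma_pt_cond R)).

Definition alpha (R : realType) (w : Thoma R) : nat -> R := (sval w).1.1.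
Definition beta (R : realType) (w : Thoma R) : nat -> R := (sval w).1.2.
Definition gamma (R : realType) (w : Thoma R) : R := (sval w).2.

(* Borel sigma-algebra of the weakest topology making all alpha_i, beta_i
   continuous = sigma-algebra generated by the coordinate maps alpha_i, beta_i *)
Definition thoma_gen (R : realType) : set (set (Thoma R)) :=
  [set A | exists i (B : set R), measurable B /\
     (A = (fun w => alpha w i) @^-1` B \/ A = (fun w => beta w i) @^-1` B)].

Definition ThomaM (R : realType) := g_sigma_algebraType (@thoma_gen R).

Definition Omega0 (R : realType) : set (ThomaM R) := [set w | gamma w = 0].

(* sum of a real series (its limit; all series used below converge) *)
Definition rsum (R : realType) (u : nat -> R) : R := limn (fun n => \sum_(i < n) u i).

Definition ptilde (R : realType) (w : Thoma R) (n : nat) : R :=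
  if (n <= 1)%N then 1
  else rsum (fun i => alpha w i ^+ n) + (-1) ^+ n.-1 * rsum (fun i => beta w i ^+ n).

(* complete homogeneous symmetric functions h_0, ..., h_n expressed in
   power sums via Newton's identities  n h_n = sum_{k=1}^n p_k h_{n-k} *)
Fixpoint hlist (R : realType) (p : nat -> R) (n : nat) : seq R :=
  match n with
  | 0 => [:: 1]
  | m.+1 => let s := hlist p m in
            rcons s ((m.+1)%:R^-1 * \sum_(k < m.+1) p k.+1 * nth 0 s (m - k))
  end.

Definition hpow (R : realType) (p : nat -> R) (n : nat) : R := nth 0 (hlist p n) n.

Definition hpowZ (R : realType) (p : nat -> R) (k : int) : R :=
  match k with Posz n => hpow p n | Negz _ => 0 end.

(* s_lambda as a polynomial in the power sums (Jacobi--Trudi: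
   s_lambda = det [h_{lambda_i - i + j}]), with p_n replaced by p~_n *)
Definition stilde (R : realType) (lam : seq nat) (w : ThomaM R) : R :=
  \det (\matrix_(i < size lam, j < size lam)
          hpowZ (ptilde w) ((nth 0%N lam i)%:Z - i%:Z + j%:Z)).

Definition admissible (R : realType) (z z' : R[i]) : Prop :=
  (z' = conjc z /\ ~ (exists k : int, z = k%:~R)) \/
  (exists m : int, complex.Im z = 0 /\ complex.Im z' = 0 /\
     m%:~R < complex.Re z < (m + 1)%:~R /\ m%:~R < complex.Re z' < (m + 1)%:~R).

Definition content_prod (R : realType) (z z' : R[i]) (lam : seq nat) : R[i] :=
  \prod_(i < size lam) \prod_(j < nth 0%N lam i)
     ((z + ((j%:Z - i%:Z)%:~R)) * (z' + ((j%:Z - i%:Z)%:~R))).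

Definition pochhammer (R : realType) (t : R[i]) (n : nat) : R[i] :=
  \prod_(k < n) (t + k%:R).

Definition Mz (R : realType) (z z' : R[i]) (lam : seq nat) : R[i] :=
  content_prod z z' lam / pochhammer (z * z') (psize lam)
  * ((dimY lam) ^ 2)%:R / ((psize lam)`!)%:R.

Definition nu_omega (R : realType) (w : ThomaM R) (A : set R) : R :=
  rsum (fun i => alpha w i * \1_A (alpha w i)) +
  rsum (fun i => beta w i * \1_A (- beta w i)) +
  gamma w * \1_A 0.

Definition sigma1 (R : realType) (P : probability (ThomaM R) R) (A : set R) : \bar R :=
  (\int[P]_w (nu_omega w A)%:E)%E.

(* Main.v *)
Require Import Defs.
From HB Require Import structures.
From mathcomp Require Import all_boot all_order all_algebra.
From mathcomp Require Import all_classical all_reals all_analysis.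
From mathcomp Require Import measurable_realfun complex.
From mathcomp Require Import ring lra.

Set Implicit Arguments.
Unset Strict Implicit.
Unset Printing Implicit Defensive.
Import Order.TTheory GRing.Theory Num.Theory.
Import numFieldNormedType.Exports.

(** Since [p_n] is the alternating sum of the Schur functions of the hooks of
    size [n], and a hook [(a+1, 1^k)] has ['C(a + k, k)] standard tableaux, the
    moments [m_k] of [sigma_1], which are the [P]-integrals of the extended power
    sums [p~_(k+1)], are explicit: with [n = k + 1],
    [m_k = (sum_j (-1)^j 'C(n-1, j) prod_(-j <= c < n-j) (z+c)(z'+c)) / ((t)_n n!)].
    With [s = z + z'] and [d = z - z'] these satisfy
    [(n+3)(t+n)(t+n+1) m_(k+2) - s(2n+3)(t+n) m_(k+1) - n((n+1)^2 - d^2) m_k = 0].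
    For [k = 0] the coefficient of [m_0] is [4 - d^2], nonzero by admissibility,
    which rules out an atom at [0]: combining the relations with [k = 2j] with
    the coefficients of [(1 - x^2)^m] yields polynomials [g_m] of [sigma_1]-integral
    zero which are uniformly bounded on [[-1, 1]], equal to [-(4 - d^2)] at [0], and
    tend to [0] pointwise off [0]. Dominated convergence gives [sigma_1({0}) = 0],
    and [sigma_1({0})] is the [P]-integral of [gamma]. *)

(** * The recurrence for alternating sums over hooks *)

Local Open Scope ring_scope.

(** The contents of the hook with [n] boxes and leg length [k] are the integers from [-k] to
    [n-1-k], so this is its content product. *)
Definition cprod (K : comNzRingType) (z z' : K) (n k : nat) : K :=
  \prod_(i < n) ((z + i%:R - k%:R) * (z' + i%:R - k%:R)).

(** The binomial counts the standard tableaux of that hook; dividing by [(t)_n n!] gives the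
    alternating sum of [M / dim] over the hooks of size [n]. *)
Definition hook_sum (K : comNzRingType) (z z' : K) (n : nat) : K :=
  \sum_(k < n) (-1) ^+ k * 'C(n.-1, k)%:R * cprod z z' n k.

Lemma cprodSr (K : comNzRingType) (z z' : K) n k :
  cprod z z' n.+1 k = cprod z z' n k * ((z + n%:R - k%:R) * (z' + n%:R - k%:R)).
Proof. by rewrite /cprod big_ord_recr. Qed.

Lemma cprodSS (K : comNzRingType) (z z' : K) n k :
  cprod z z' n.+1 k.+1 = ((z - k%:R - 1) * (z' - k%:R - 1)) * cprod z z' n k.
Proof.
rewrite /cprod big_ord_recl /=; congr (_ * _).
  by rewrite -[k.+1%:R]natr1; ring.
by apply: eq_bigr => i _; rewrite /bump /= !add1n -!natr1; congr (_ * _); ring.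
Qed.

(** Padding by zero terms gives the three sums of the recurrence a common range. *)
Lemma hook_sum_widen (K : comNzRingType) (z z' : K) n m : (n < m)%N ->
  hook_sum z z' n.+1 = \sum_(k < m) (-1) ^+ k * 'C(n, k)%:R * cprod z z' n.+1 k.
Proof.
move=> nm; rewrite /hook_sum /= (big_ord_widen m (fun k => (-1) ^+ k * 'C(n, k)%:R * cprod z z' n.+1 k)) //.
rewrite [RHS](bigID (fun k : 'I_m => (k < n.+1)%N)) /= [X in _ + X]big1 ?addr0 // => i.
by rewrite -leqNgt => ni; rewrite bin_small // mulr0 mul0r.
Qed.

(* Zeilberger's algorithm: [hook_cert] is the certificate of the recurrence [hook_sum_rec]. *)
Definition hook_cert (K : comNzRingType) (z z' : K) (n k : nat) : K :=
  let N := n%:R in let x := k%:R in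
  (-1) ^+ k * cprod z z' n.+1 k * (x * 'C(n.+1, k)%:R) *
  ((3 + 8 * N + 7 * N ^+ 2 + 2 * N ^+ 3) - (3 + N) * (z * z')
   - (1 + N) * (z + z') + x * (z + z' - 4 - 7 * N - 3 * N ^+ 2)
   + x ^+ 2 * (1 + N)).

(** The factor [N + 1] clears the denominators that arise when every binomial is written through
    ['C(n.+1, k)]. All content products are multiples of [cprod z z' n k], so a polynomial identity
    remains. *)
Lemma hook_certP (K : comNzRingType) (z z' : K) (n k : nat) : (0 < n)%N ->
  let N := n%:R in
  (N + 1) * ((N + 3) * ((-1) ^+ k * 'C(n.+1, k)%:R * cprod z z' n.+2 k)
   - (z + z') * (2 * N + 3) * (N + 2) * ((-1) ^+ k * 'C(n, k)%:R * cprod z z' n.+1 k)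
   - N * (N + 1) * (N + 2) * ((N + 1) ^+ 2 - ((z + z') ^+ 2 - 4 * (z * z'))) *
     ((-1) ^+ k * 'C(n.-1, k)%:R * cprod z z' n k))
  = hook_cert z z' n k.+1 - hook_cert z z' n k.
Proof.
move=> n0 /=; rewrite /hook_cert.
have e1 : (k.+1)%:R * 'C(n.+1, k.+1)%:R = (n%:R + 1 - k%:R) * 'C(n.+1, k)%:R :> K.
  have [kn|nk] := leqP k n.+1.
    by rewrite -natrM mul_bin_left natrM natrB // -natr1.
  by rewrite !bin_small ?mulr0 // ltnW.
have e2 : (n%:R + 1) * 'C(n, k)%:R = (n%:R + 1 - k%:R) * 'C(n.+1, k)%:R :> K.
  have [kn|nk] := leqP k n.+1.
    by rewrite natr1 -natrM -[X in (X * _)%N]/(n.+1) mul_bin_down natrM natrB // -natr1.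
  by rewrite !bin_small ?mulr0 // ltnW.
have e3 : (n%:R) * 'C(n.-1, k)%:R = (n%:R - k%:R) * 'C(n, k)%:R :> K.
  case: n n0 {e1 e2} => // n _ /=.
  have [kn|nk] := leqP k n.+1.
    by rewrite -natrM mul_bin_down natrM natrB.
  by rewrite !bin_small ?mulr0 // ltnW.
rewrite e1 !cprodSS !cprodSr [(-1) ^+ k.+1]exprS -[k.+1%:R]natr1 -[n.+1%:R]natr1.
set s := (-1) ^+ k; set Q := cprod _ _ _ _; set N := n%:R in e2 e3 *; set x := k%:R in e2 e3 *.
set C := 'C(n.+1, k)%:R in e2 *; set C1 := 'C(n, k)%:R in e2 e3 *; set C2 := 'C(n.-1, k)%:R in e3 *.
(* Each binomial is moved next to the factor that [e2] and [e3] absorb. *)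
transitivity ((N + 3) * (s * ((N + 1) * C) * (Q * ((z + N - x) * (z' + N - x)) * ((z + (N + 1) - x) * (z' + (N + 1) - x))))
  - (z + z') * (2 * N + 3) * (N + 2) * (s * ((N + 1) * C1) * (Q * ((z + N - x) * (z' + N - x))))
  - (N + 1) * (N + 2) * ((N + 1) ^+ 2 - ((z + z') ^+ 2 - 4 * (z * z'))) * (s * ((N + 1) * (N * C2)) * Q)).
  ring.
rewrite e3 [(N + 1) * (_ * _)]mulrCA !e2.
ring.
Qed.

(** The certificate telescopes over [k < n.+2]. Its upper end vanishes because ['C(n.+1, n.+2) = 0],
    its lower end because of the factor [x = 0]. *)
Lemma hook_sum_rec (K : numFieldType) (z z' : K) (n : nat) : (0 < n)%N ->
  let N := n%:R in
  (N + 3) * hook_sum z z' n.+2 - (z + z') * (2 * N + 3) * (N + 2) * hook_sum z z' n.+1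
  - N * (N + 1) * (N + 2) * ((N + 1) ^+ 2 - ((z + z') ^+ 2 - 4 * (z * z'))) * hook_sum z z' n
  = 0.
Proof.
move=> n0 N; have N1 : N + 1 != 0 by rewrite natr1 pnatr_eq0.
apply: (mulfI N1); rewrite mulr0.
rewrite (@hook_sum_widen _ _ _ n.+1 n.+2) // (@hook_sum_widen _ _ _ n n.+2) //.
have -> : hook_sum z z' n = \sum_(k < n.+2) (-1) ^+ k * 'C(n.-1, k)%:R * cprod z z' n k.
  by case: n n0 @N N1 => // n _ _ _; rewrite (@hook_sum_widen _ _ _ n n.+3) // ltnW // ltnW.
rewrite !mulr_sumr -!sumrB mulr_sumr.
under eq_bigr do rewrite hook_certP //.
rewrite -(big_mkord xpredT (fun k => hook_cert z z' n k.+1 - hook_cert z z' n k)) telescope_sumr //.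
by rewrite /hook_cert (@bin_small n.+1 n.+2) // !(mulr0, mul0r) subr0.
Qed.

(** * Standard tableaux of hook shape *)

Local Close Scope ring_scope.

(** Frobenius notation [(a | k)]: arm length [a] and leg length [k], the corner counted in
    neither. *)
Definition hook (a k : nat) : seq nat := a.+1 :: nseq k 1%N.

Lemma hook_partition a k : is_partition (hook a k).
Proof.
rewrite /is_partition /hook /=; apply/andP; split; last by elim: k.
by case: k => //= k; elim: k.
Qed.

Lemma psize_hook a k : psize (hook a k) = (a + k).+1.
Proof. by rewrite /psize /hook /= sumn_nseq mul1n addSn. Qed.

Lemma nth_hook_leg a k i : nth 0%N (hook a k) i.+1 = (i < k)%N.
Proof. by rewrite /= nth_nseq; case: ltnP. Qed.

(** The value lists are strictly sorted, and a strictly sorted list is determined by its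
    elements. *)
Lemma increasing_unique (k n : nat) (f g : 'I_k -> 'I_n) :
  {homo f : i j / (i < j)%N} -> {homo g : i j / (i < j)%N} ->
  [set f i | i : 'I_k] = [set g i | i : 'I_k] -> f =1 g.
Proof.
pose s (h : 'I_k -> 'I_n) := [seq nat_of_ord (h i) | i <- enum 'I_k].
have s_sorted (h : 'I_k -> 'I_n) : {homo h : i j / (i < j)%N} -> sorted ltn (s h).
  move=> hh; rewrite /s sorted_map.
  have : sorted (relpre (@nat_of_ord k) ltn) (enum 'I_k).
    by rewrite -sorted_map val_enum_ord iota_ltn_sorted.
  by apply: sub_sorted => i j /=; apply: hh.
move=> hf hg fg.
have : s f = s g.
  apply: (irr_sorted_eq ltn_trans ltnn) (s_sorted _ hf) (s_sorted _ hg) _ => x.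
  have s_mem (h : 'I_k -> 'I_n) : (x \in s h) = (x \in [seq nat_of_ord y | y in [set h i | i : 'I_k]]).
    apply/mapP/mapP => [[i _ ->]|[y]].
      by exists (h i); rewrite // mem_enum; apply/imsetP; exists i.
    by rewrite mem_enum => /imsetP[i _ ->] ->; exists i; rewrite ?mem_enum.
  by rewrite !s_mem fg.
move=> /eq_in_map sfg i; apply: val_inj; apply: sfg; exact: mem_enum.
Qed.

Lemma enum_set_increasing (n : nat) (A : {set 'I_n.+1}) (i j : nat) :
  (i < j < #|A|)%N -> (nth ord0 (enum A) i < nth ord0 (enum A) j)%N.
Proof.
move=> /andP[ij jA].
have sA : sorted (relpre (@nat_of_ord n.+1) ltn) (enum A).
  rewrite {1}/enum_mem -enumT; apply: sorted_filter; first by move=> ? ? ?; apply: ltn_trans.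
  by rewrite -sorted_map val_enum_ord iota_ltn_sorted.
have tr : transitive (relpre (@nat_of_ord n.+1) ltn) by move=> ? ? ?; apply: ltn_trans.
apply: (sorted_ltn_nth tr ord0 sA); rewrite ?inE -?cardE //.
exact: ltn_trans jA.
Qed.

Section HookTableaux.
Variables a k : nat.
Let lam := hook a k.
Let box := box lam.
(** [N.+1] is the form to which [psize lam] reduces, so fillings with values in ['I_N.+1] fit
    [is_SYT] without a cast. *)
Let N := (a + sumn (nseq k 1%N))%N.

Let NE : N.+1 = (a + k).+1. Proof. exact: psize_hook. Qed.
Let size_lam : (size (nseq k 1%N)).+1 = k.+1. Proof. by rewrite size_nseq. Qed.

(** [arm] runs through the whole first row, corner included; [leg] starts just below the corner. *)
Let arm_proof (j : 'I_a.+1) : @box_pred lam (ord0 : 'I_(size (nseq k 1%N)).+1, j).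
Proof. exact: ltn_ord. Qed.
Let arm j : box := exist _ (_, _) (arm_proof j).

Let leg_proof (i : 'I_k) :
  @box_pred lam (inord i.+1 : 'I_(size (nseq k 1%N)).+1, ord0 : 'I_a.+1).
Proof. by rewrite /box_pred /= inordK ?nth_hook_leg ?size_lam ?ltnS ?ltn_ord. Qed.
Let leg i : box := exist _ (_, _) (leg_proof i).

Let leg1 i : (val (leg i)).1 = i.+1 :> nat.
Proof. by rewrite /= inordK // size_lam ltnS. Qed.

Let leg_inj : injective leg.
Proof. by move=> i i' e; apply/val_inj/succn_inj; rewrite /= -!leg1 e. Qed.

Let arm_inj : injective arm.
Proof. by move=> j j' e; apply: val_inj; rewrite -[LHS]/(val (val (arm j)).2) e. Qed.

Let boxP (b : box) : (exists j, b = arm j) \/ (exists i, b = leg i).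
Proof.
case: b => [[i j] ij]; have := ij; rewrite /box_pred /=.
case: (posnP i) => [i0 _|i0 ijk].
  by left; exists j; apply: val_inj; congr pair; apply: val_inj.
have ik : (i.-1 < k)%N.
  have il : (i < (size (nseq k 1%N)).+1)%N := ltn_ord i.
  by rewrite size_lam in il; rewrite -ltnS prednK.
right; exists (Ordinal ik); apply: val_inj; congr pair; apply: val_inj.
  by rewrite /= inordK ?prednK // size_lam ltnS; exact: ltnW.
by move: ijk; rewrite -(prednK i0) /= nth_nseq ik; case: (nat_of_ord j).
Qed.

Let legs (T : {ffun box -> 'I_N.+1}) : {set 'I_N.+1} := [set T (leg i) | i : 'I_k].

(** Distinct boxes in one row are both in the arm. Distinct boxes in one column are both in the leg,
    or one of them is the corner. *)
Let SYTP (T : {ffun box -> 'I_N.+1}) :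
  reflect [/\ injective T, {homo T \o arm : j j' / (j < j')%N},
    {homo T \o leg : i i' / (i < i')%N} & forall i, (T (arm ord0) < T (leg i))%N]
  (@is_SYT lam T).
Proof.
apply: (iffP andP) => [[/injectiveP Ti /forallP T2]|[Ti Ta Tl T0]].
  split=> // [j j' jj'|i i' ii'|i].
  - have /forallP/(_ (arm j'))/andP[/implyP + _] := T2 (arm j).
    by apply; rewrite /= ?eqxx.
  - have /forallP/(_ (leg i'))/andP[_ /implyP +] := T2 (leg i).
    by apply; rewrite !leg1 eqxx ltnS.
  - have /forallP/(_ (leg i))/andP[_ /implyP +] := T2 (arm ord0).
    by apply; rewrite leg1 eqxx.
split; first exact/injectiveP.
apply/forallP => b; apply/forallP => b'.
have [[j ->]|[i ->]] := boxP b; have [[j' ->]|[i' ->]] := boxP b'; apply/andP; split;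
  apply/implyP => /andP[/eqP e lt].
- exact: Ta.
- by move: lt; rewrite ltnn.
- by move: lt; rewrite ltn0.
- by have -> : j = ord0 by []; exact: T0.
- by have := congr1 (@nat_of_ord _) e; rewrite leg1.
- by move: lt; rewrite leg1 ltn0.
- by move: lt; rewrite ltnn.
- by apply: Tl; move: lt; rewrite !leg1.
Qed.

(** Injectivity makes the two sets of entries disjoint, and their sizes add up to [N.+1]. *)
Let arms_legs (T : {ffun box -> 'I_N.+1}) : injective T -> [set T (arm j) | j : 'I_a.+1] = ~: legs T.
Proof.
move=> Ti; apply/eqP; rewrite eqEcard; apply/andP; split.
  apply/fintype.subsetP => x /imsetP[j _ ->]; rewrite finset.inE; apply/negP => /imsetP[i _ /Ti e].
  by have := leg1 i; rewrite -e.
have C : (#|legs T| + #|~: legs T| = (a + k).+1)%N by rewrite cardsC card_ord NE.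
rewrite card_imset ?card_ord; last exact: inj_comp Ti arm_inj.
move: C; rewrite card_imset ?card_ord; last exact: inj_comp Ti leg_inj.
by move=> /eqP; rewrite -addSn addnC eqn_add2r => /eqP->.
Qed.

(** A tableau is determined by its set of leg entries, which can be any [k] of the [a + k] values
    other than the minimum; the minimum sits in the corner. *)
Lemma dimY_hook : dimY (hook a k) = 'C(a + k, k).
Proof.
(* The classical set in [dimY] is exchanged for a finite set. *)
have -> : dimY lam = #|[set T : {ffun box -> 'I_N.+1} | @is_SYT lam T]|.
  by apply: eq_card => T; rewrite [RHS]finset.inE; apply/idP/idP => [/set_mem|/mem_set].
have -> : 'C(a + k, k) =
    #|[set B : {set 'I_N.+1} | (B \subset [set~ ord0]) && (#|B| == k)]|.
  by rewrite cards_draws cardsC1 card_ord NE.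
have legs_inj : {in [set T | @is_SYT lam T] &, injective legs}.
  move=> T T'; rewrite !finset.inE => /SYTP[Ti Ta Tl T0] /SYTP[Ti' Ta' Tl' T0'] TT'.
  have eT : T \o leg =1 T' \o leg by apply: increasing_unique.
  have eT' : T \o arm =1 T' \o arm.
    by apply: increasing_unique; rewrite // !arms_legs // TT'.
  by apply/ffunP => b; have [[j ->]|[i ->]] := boxP b; [exact: eT'|exact: eT].
rewrite -(card_in_imset legs_inj); apply: eq_card => A; rewrite [RHS]finset.inE.
apply/imsetP/andP => [[T]|[A0 /eqP Ak]].
  rewrite finset.inE => /SYTP[Ti _ _ T0] ->; split.
    apply/fintype.subsetP => x /imsetP[i _ ->]; rewrite !finset.inE -val_eqE /= -lt0n.
    exact: leq_trans (T0 i).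
  by rewrite card_imset ?card_ord //; exact: inj_comp Ti leg_inj.
have Ca : #|~: A| = a.+1.
  have C : (#|A| + #|~: A| = (a + k).+1)%N by rewrite cardsC card_ord NE.
  by move: C; rewrite Ak -addSn addnC => /eqP; rewrite eqn_add2r => /eqP.
(* The inverse map: [A] is written in increasing order down the leg, its complement along the first
   row. The predecessor appears because leg box [i] lies in row [i.+1]. *)
pose T : {ffun box -> 'I_N.+1} := [ffun b : box =>
  if nat_of_ord (val b).1 == 0%N then nth ord0 (enum (~: A)) (val b).2
  else nth ord0 (enum A) (val b).1.-1].
have Tarm j : T (arm j) = nth ord0 (enum (~: A)) j by rewrite ffunE.
have Tleg i : T (leg i) = nth ord0 (enum A) i by rewrite ffunE leg1.
have TA i : T (leg i) \in A by rewrite Tleg -mem_enum mem_nth // -cardE Ak.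
have TC j : T (arm j) \notin A.
  by rewrite Tarm -finset.in_setC -mem_enum mem_nth // -cardE Ca.
have Ta : {homo T \o arm : j j' / (j < j')%N}.
  by move=> j j' jj' /=; rewrite !Tarm; apply: enum_set_increasing; rewrite jj' Ca /=.
have Tl : {homo T \o leg : i i' / (i < i')%N}.
  by move=> i i' ii' /=; rewrite !Tleg; apply: enum_set_increasing; rewrite ii' Ak /=.
have homo_inj m (f : 'I_m -> 'I_N.+1) : {homo f : i j / (i < j)%N} -> injective f.
  move=> hf i j /eqP; apply: contraTeq; rewrite -val_eqE /= neq_ltn => /orP[] /hf.
    by move=> h; rewrite -val_eqE /= ltn_eqF.
  by move=> h; rewrite -val_eqE /= gtn_eqF.
have Ti : injective T.
  move=> b b'; have [[j ->]|[i ->]] := boxP b; have [[j' ->]|[i' ->]] := boxP b' => e.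
  - by rewrite (homo_inj _ _ Ta _ _ e).
  - by have := TC j; rewrite e TA.
  - by have := TC j'; rewrite -e TA.
  - by rewrite (homo_inj _ _ Tl _ _ e).
have TAE : A = legs T.
  apply/eqP; rewrite eq_sym eqEcard; apply/andP; split.
    by apply/fintype.subsetP => x /imsetP[i _ ->].
  by rewrite card_imset ?card_ord ?Ak //; exact: inj_comp Ti leg_inj.
exists T => //; rewrite finset.inE; apply/SYTP; split => // i.
(* The value [0] is not in [A], so it is an arm entry, and monotonicity puts it in the corner;
   injectivity then makes the leg entries positive. *)
have : (ord0 : 'I_N.+1) \in ~: A.
  by rewrite finset.inE; apply/negP => /(fintype.subsetP A0); rewrite !finset.inE eqxx.
rewrite TAE -arms_legs // => /imsetP[j _ Tj].
have Tj0 : T (arm ord0) = ord0.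
  case: (posnP j) => [j0|j0]; first by rewrite Tj; congr (T (arm _)); apply: val_inj.
  by have := Ta ord0 j j0; rewrite /= -Tj.
rewrite Tj0 lt0n; apply/negP => /eqP Ti0.
have : T (leg i) = T (arm ord0) by rewrite Tj0; apply: val_inj.
by move/Ti => e; have := leg1 i; rewrite e.
Qed.

End HookTableaux.

(** * Power sums as alternating sums of hook Schur functions *)

Local Open Scope ring_scope.

Section Convolution.
Variable K : comNzRingType.
Implicit Types f g h : nat -> K.

Definition conv f g n : K := \sum_(l < n.+1) f l * g (n - l)%N.

(** Truncation to polynomials transfers commutativity and associativity of multiplication to
    [conv]. *)
Let coef_conv f g n N : (n < N)%N ->
  conv f g n = ((\poly_(i < N) f i) * (\poly_(i < N) g i))`_n.
Proof.
move=> nN; rewrite coefM; apply: eq_bigr => l _.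
rewrite !coef_poly (leq_ltn_trans _ nN) ?(leq_ltn_trans _ nN) ?leq_subr //.
by rewrite -ltnS.
Qed.

Lemma convC f g n : conv f g n = conv g f n.
Proof. by rewrite (coef_conv _ _ (ltnSn n)) mulrC -coef_conv. Qed.

Lemma convA f g h n : conv f (conv g h) n = conv (conv f g) h n.
Proof.
have E u v : (forall i, (i < n.+1)%N -> u`_i = v i) ->
    (forall w, \sum_(l < n.+1) w`_l * u`_(n - l) = \sum_(l < n.+1) w`_l * v (n - l)%N :> K).
  by move=> uv w; apply: eq_bigr => l _; rewrite uv // ltnS leq_subr.
pose P u := \poly_(i < n.+1) (u i : K).
have PP u v i : (i < n.+1)%N -> (P u * P v)`_i = conv u v i.
  by move=> ?; rewrite -coef_conv.
have -> : conv f (conv g h) n = (P f * (P g * P h))`_n.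
  rewrite coefM; apply: eq_bigr => l _.
  by rewrite PP ?ltnS ?leq_subr // coef_poly ltn_ord.
rewrite mulrA coefM; apply: eq_bigr => l _.
by rewrite PP // coef_poly ltnS leq_subr.
Qed.

Lemma eq_conv f f' g g' n :
  (forall i, (i <= n)%N -> f i = f' i) -> (forall i, (i <= n)%N -> g i = g' i) ->
  conv f g n = conv f' g' n.
Proof.
move=> ff gg; apply: eq_bigr => l _; rewrite ff ?gg ?leq_subr //.
by rewrite -ltnS.
Qed.

Lemma conv_delta f n : conv f (fun i => (i == 0%N)%:R) n = f n.
Proof.
rewrite /conv big_ord_recr /= subnn mulr1 big1 ?add0r // => i _.
by rewrite subn_eq0 leqNgt ltn_ord mulr0.
Qed.

End Convolution.

Section JacobiTrudiHook.
Variables (K : comNzRingType) (H : int -> K).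
Hypothesis H0 : H 0 = 1.
Hypothesis Hneg : forall n, H (Negz n) = 0.

(** [H] stands for the complete symmetric functions. The order [m] is separate from [lam], so that
    [size (hook a k)] can be replaced by [k.+1]. *)
Definition jt_det (lam : seq nat) (m : nat) : K :=
  \det (\matrix_(i < m, j < m) H ((nth 0%N lam i)%:Z - i%:Z + j%:Z)).

(** The elementary symmetric function [e_n], as the Schur function of a single column. *)
Let elem (n : nat) : K := if n is k.+1 then jt_det (hook 0 k) k.+1 else 1.

(** This is the Pieri rule for a row times a column. The first column of the matrix is
    [H a.+1, 1, 0, ..., 0], so the expansion has two terms: one minor belongs to a column, the other
    to a hook with longer arm. *)
Lemma jt_hook_rec a k :
  jt_det (hook a k.+1) k.+2 = H a.+1%:Z * elem k.+1 - jt_det (hook a.+1 k) k.+1.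
Proof.
rewrite /jt_det (expand_det_col _ ord0) 2!big_ord_recl big1 ?addr0; last first.
  move=> i _; rewrite !mxE /= nth_nseq ltn_ord /bump /= !add1n.
  have -> : (1%N%:Z - i.+2%:Z + 0) = Negz i by rewrite NegzE; ring.
  by rewrite Hneg mul0r.
rewrite !mxE /= addr0 subr0 subrr H0 mul1r /cofactor /=.
rewrite expr0 mul1r /bump /= expr1 mulN1r; congr (_ * _ - _).
  rewrite /elem /jt_det; congr (\det _); apply/matrixP => i j; rewrite !mxE /=.
  by rewrite /bump /= !add1n /= add0n /hook !intS; congr H; ring.
rewrite /jt_det; congr (\det _); apply/matrixP => i j; rewrite !mxE /=.
by case: i => [[|i]] ik; congr H; rewrite /= /bump /= ?add1n !intS; ring.
Qed.

(** Iterating [jt_hook_rec] shortens the leg one box at a time, down to a single row. *)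
Lemma jt_hook_conv a k : (-1) ^+ k * jt_det (hook a k) k.+1 =
  \sum_(l < k.+1) ((-1) ^+ l * elem l) * H (a.+1 + (k - l))%N%:Z.
Proof.
elim: k a => [|k IH] a.
  by rewrite big_ord1 expr0 !mul1r addn0 /jt_det det_mx11 mxE /= subr0 addr0.
rewrite jt_hook_rec mulrBr [X in _ - X](_ : _ = - ((-1) ^+ k * jt_det (hook a.+1 k) k.+1)).
  rewrite opprK IH [RHS]big_ord_recr /= subnn addn0 [RHS]addrC; congr (_ + _); first by rewrite mulrA mulrAC.
  by apply: eq_bigr => l _; rewrite subSn ?addSnnS // -ltnS.
by rewrite exprS; ring.
Qed.

(** In generating functions, [E(-u) H(u) = 1]. This is [jt_hook_conv] for [a = 0], where the hook is
    itself a column. *)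
Lemma conv_elem n :
  conv (fun l => (-1) ^+ l * elem l) (fun l => H l%:Z) n = (n == 0%N)%:R.
Proof.
case: n => [|k]; first by rewrite /conv big_ord1 expr0 !mul1r H0.
rewrite /conv big_ord_recr /= subnn H0 mulr1.
rewrite (eq_bigr (fun l : 'I_k.+1 => ((-1) ^+ l * elem l) * H (1 + (k - l))%N%:Z)).
  by rewrite -jt_hook_conv exprS /elem; ring.
by move=> l _; rewrite add1n subSn // -ltnS.
Qed.

(** Newton's identities say [u H'(u) = P(u) H(u)], hence [P(u) = E(-u) u H'(u)]. The alternating
    hook sum is the coefficient of the right-hand side: by [jt_hook_conv] the product
    [e l * h (n.+1 - l)] occurs once for each [k] from [l] to [n], that is [n.+1 - l] times. *)
Lemma sum_hooks (p : nat -> K) n :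
  (forall m, m.+1%:R * H m.+1%:Z = \sum_(k < m.+1) p k.+1 * H (m - k)%N%:Z) ->
  \sum_(k < n.+1) (-1) ^+ k * jt_det (hook (n - k) k) k.+1 = p n.+1.
Proof.
move=> newton; pose e l := (-1) ^+ l * elem l; pose h l := H (Posz l).
pose q i := if i is m.+1 then p m.+1 else 0.
have Dh m : m%:R * h m = conv q h m.
  case: m => [|m]; first by rewrite /conv big_ord1 /q /= ?mulr0n !mul0r.
  by rewrite newton /conv [RHS]big_ord_recl /= mul0r add0r.
transitivity (conv e (fun m => m%:R * h m) n.+1); last first.
  rewrite (@eq_conv _ _ e _ (conv q h)) // convA.
  rewrite (@eq_conv _ _ (conv q e) _ h) //; last by move=> i _; rewrite convC.
  rewrite -convA (@eq_conv _ _ q _ (fun i => (i == 0%N)%:R)) //.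
    by rewrite conv_delta.
  by move=> i _; exact: conv_elem.
rewrite /conv [RHS]big_ord_recr /= subnn mul0r mulr0 addr0.
transitivity (\sum_(k < n.+1) \sum_(l < n.+1 | (l <= k)%N) e l * h (n.+1 - l)%N).
  apply: eq_bigr => k _; rewrite jt_hook_conv.
  rewrite (big_ord_widen n.+1 (fun l => (-1) ^+ l * elem l * H ((n - k).+1 + (k - l))%N)) //.
  apply: eq_big => l; first by rewrite ltnS.
  rewrite ltnS => lk; congr (_ * H (Posz _)).
  by rewrite addSn addnBA // subnK ?subSn // -ltnS.
rewrite (exchange_big_dep xpredT) //=; apply: eq_bigr => l _.
rewrite sumr_const mulrCA mulr_natl; congr (_ *+ _).
rewrite -sum1_card (_ : (\sum_(k in _) 1)%N = (\sum_(l <= k < n.+1) 1)%N).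
  by rewrite sum_nat_const_nat muln1.
by rewrite big_geq_mkord; apply: eq_bigl => k; rewrite andTb.
Qed.

End JacobiTrudiHook.

Section Newton.
Variables (R : realType) (p : nat -> R).

Lemma size_hlist n : size (hlist p n) = n.+1.
Proof. by elim: n => //= n IH; rewrite size_rcons IH. Qed.

Lemma nth_hlist n i : (i <= n)%N -> nth 0 (hlist p n) i = hpow p i.
Proof.
elim: n => [|n IH]; first by rewrite leqn0 => /eqP ->.
rewrite leq_eqVlt => /predU1P[->//|]; rewrite ltnS => ilen.
by rewrite /= nth_rcons size_hlist ltnS ilen IH.
Qed.

Lemma hpow_newton n :
  n.+1%:R * hpow p n.+1 = \sum_(k < n.+1) p k.+1 * hpow p (n - k)%N.
Proof.
rewrite {1}/hpow /= nth_rcons size_hlist ltnn eqxx mulrA divff ?mul1r ?pnatr_eq0 //.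
by apply: eq_bigr => k _; rewrite nth_hlist // leq_subr.
Qed.

End Newton.

Lemma stilde_jt (R : realType) a k (w : ThomaM R) :
  stilde (hook a k) w = jt_det (hpowZ (ptilde w)) (hook a k) k.+1.
Proof.
rewrite -[LHS]/(jt_det (hpowZ (ptilde w)) (hook a k) (size (nseq k 1%N)).+1).
by rewrite size_nseq.
Qed.

Lemma sum_stilde_hooks (R : realType) n (w : ThomaM R) :
  \sum_(k < n.+1) (-1) ^+ k * stilde (hook (n - k) k) w = ptilde w n.+1.
Proof.
under eq_bigr do rewrite stilde_jt.
by apply: sum_hooks => // m; exact: hpow_newton.
Qed.

(** * The z-measure on hooks *)

Section ZMeasureOnHooks.
Variables (R : realType) (z z' : R[i]).

Lemma content_prod_hook a k :
  content_prod z z' (hook a k) = cprod z z' (a + k).+1 k.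
Proof.
pose f (i j : nat) := (z + (j%:Z - i%:Z)%:~R) * (z' + (j%:Z - i%:Z)%:~R).
have -> : content_prod z z' (hook a k) =
    \prod_(j < a.+1) f 0%N j * \prod_(i < k) f i.+1 0%N.
  rewrite -[LHS]/(\prod_(i < (size (nseq k 1%N)).+1) \prod_(j < nth 0%N (hook a k) i) f i j).
  rewrite size_nseq big_ord_recl; congr (_ * _); apply: eq_bigr => i _.
  by rewrite lift0 /= nth_nseq ltn_ord big_ord1.
elim: k => [|k IH].
  rewrite big_ord0 mulr1 addn0; apply: eq_bigr => j _.
  by rewrite /f !subr0.
rewrite [X in _ * X]big_ord_recr /= mulrA IH addnS cprodSS mulrC; congr (_ * _).
by rewrite /f add0r !rmorphN /= -pmulrn -natr1; congr (_ * _); ring.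
Qed.

Lemma dimY_hook_neq0 a k : (dimY (hook a k))%:R != 0 :> R[i].
Proof. by rewrite dimY_hook pnatr_eq0 -lt0n bin_gt0 leq_addl. Qed.

Lemma Mz_hook a k : Mz z z' (hook a k) / (dimY (hook a k))%:R =
  'C(a + k, k)%:R * cprod z z' (a + k).+1 k /
  (pochhammer (z * z') (a + k).+1 * (a + k).+1`!%:R).
Proof.
rewrite /Mz content_prod_hook psize_hook -mulnn natrM.
have := dimY_hook_neq0 a k; rewrite dimY_hook => d0.
by rewrite invfM mulrAC mulrA mulfK // !mulrA; congr (_ / _); rewrite mulrC mulrA.
Qed.

Lemma hook_sum_Mz n :
  \sum_(k < n.+1) (-1) ^+ k * (Mz z z' (hook (n - k) k) / (dimY (hook (n - k) k))%:R) =
  hook_sum z z' n.+1 / (pochhammer (z * z') n.+1 * n.+1`!%:R).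
Proof.
rewrite /hook_sum mulr_suml; apply: eq_bigr => k _.
have kn : (k <= n)%N by rewrite -ltnS.
by rewrite Mz_hook (subnK kn) [LHS]mulrA [X in X / _]mulrA.
Qed.

(** Index [n] belongs to hooks with [n.+1] boxes, because the [n]-th moment of [sigma_1] is the
    integral of the power sum of degree [n.+1]. *)
Definition hook_moment n : R[i] := hook_sum z z' n.+1 / (pochhammer (z * z') n.+1 * n.+1`!%:R).

Lemma hook_moment_rec j : (forall i : nat, z * z' + i%:R != 0) ->
  let n : R[i] := j%:R + 1 in
  (n + 3) * (z * z' + n) * (z * z' + n + 1) * hook_moment j.+2
  - (z + z') * (2 * n + 3) * (z * z' + n) * hook_moment j.+1
  - n * ((n + 1) ^+ 2 - ((z + z') ^+ 2 - 4 * (z * z'))) * hook_moment j = 0.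
Proof.
move=> t0 n; have nE : n = j.+1%:R by rewrite /n natr1.
have P0 i : pochhammer (z * z') i != 0 by apply/prodf_neq0 => k _; exact: t0.
have f0 i : i`!%:R != 0 :> R[i] by rewrite pnatr_eq0 -lt0n fact_gt0.
have PS i : pochhammer (z * z') i.+1 = pochhammer (z * z') i * (z * z' + i%:R).
  by rewrite /pochhammer big_ord_recr.
have := @hook_sum_rec _ z z' j.+1 isT; rewrite -nE /hook_moment.
have fS i : i.+1`!%:R = i.+1%:R * i`!%:R :> R[i] by rewrite factS natrM.
rewrite (PS j.+2) (PS j.+1) (fS j.+2) (fS j.+1).
have := t0 j.+1; have := t0 j.+2; have := P0 j.+1; have := f0 j.+1.
have : j.+2%:R != 0 :> R[i] by rewrite pnatr_eq0.
have : j.+3%:R != 0 :> R[i] by rewrite pnatr_eq0.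
rewrite -[j.+3%:R]natr1 -[j.+2%:R]natr1 -nE.
set U2 := hook_sum z z' j.+3; set U1 := hook_sum z z' j.+2; set U0 := hook_sum z z' j.+1.
set P := pochhammer _ _; set F := _`!%:R; set t := z * z'.
clearbody n => n2 n1 F0 P00 tn1 tn rec.
(* The common denominator is [(t)_n n! (n+1)(n+2)]; the ratios of Pochhammer symbols cancel the
   factors [t + n] and [t + n + 1]. *)
transitivity (((n + 3) * U2 - (z + z') * (2 * n + 3) * (n + 2) * U1 -
      n * (n + 1) * (n + 2) * ((n + 1) ^+ 2 - ((z + z') ^+ 2 - 4 * t)) * U0)
      / (P * F * (n + 1) * (n + 1 + 1))).
  by field; rewrite ?F0 ?P00 ?n1 ?n2 ?tn /= ?addrA; move: tn1; rewrite ?addrA.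
by rewrite rec mul0r.
Qed.

(** Here [s^2 - 4t = (z - z')^2]. It is nonpositive for conjugate parameters and less than 1 for
    real ones in a common unit interval. *)
Lemma admissible_real : admissible z z' ->
  exists t s : R, [/\ 0 < t, 0 < 4 - (s ^+ 2 - 4 * t), z * z' = t%:C & z + z' = s%:C]%C.
Proof.
case: z z' => a b [c d]; case=> [[] /= [-> ->] zZ|[m /= [-> [-> [/andP[ma am] /andP[mc cm]]]]]].
  exists (a ^+ 2 + b ^+ 2), (2 * a); split.
  - have [b0|b0] := eqVneq b 0; last first.
      by rewrite ltr_wpDl ?sqr_ge0 // exprn_even_gt0.
    have [a0|a0] := eqVneq a 0; last by rewrite ltr_pwDl ?sqr_ge0 // exprn_even_gt0.
    by exfalso; apply: zZ; exists 0; rewrite a0 b0.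
  - by have := sqr_ge0 b; nra.
  - by apply/eqP; rewrite eq_complex /=; apply/andP; split; apply/eqP; ring.
  - by apply/eqP; rewrite eq_complex /=; apply/andP; split; apply/eqP; ring.
move: am cm; rewrite intrD => am cm.
exists (a * c), (a + c); split.
(* An interval [(m, m+1)] does not contain [0], so both parameters have the same sign. *)
- have [m0|m0] := leP 0 m.
    have m0' : 0 <= m%:~R :> R by rewrite ler0z.
    by apply: mulr_gt0; lra.
  have m0' : m%:~R + 1 <= 0 :> R by rewrite -[1]/(1%:~R) -intrD lerz0 lezD1.
  by rewrite nmulr_rgt0; lra.
- nra.
- by apply/eqP; rewrite eq_complex /=; apply/andP; split; apply/eqP; ring.
- by apply/eqP; rewrite eq_complex /=; apply/andP; split; apply/eqP; ring.
Qed.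

End ZMeasureOnHooks.

(** * Alternating binomial sums *)

Local Open Scope classical_set_scope.
Local Open Scope ring_scope.

Section AlternatingBinomialSums.
Variable R : realType.
Implicit Types (e : nat -> R) (y : R).

(** The expansion of [(1 - y)^m] with its coefficients weighted by [e]. *)
Definition altbin e m y : R :=
  \sum_(j < m.+1) (-1) ^+ j * 'C(m, j)%:R * e j * y ^+ j.

Lemma altbinS e m y :
  altbin e m.+1 y = altbin e m y - y * altbin (e \o succn) m y.
Proof.
rewrite /altbin big_ord_recl [X in _ = X - _](_ : _ = \sum_(j < m.+2) (-1) ^+ j * 'C(m, j)%:R * e j * y ^+ j); last first.
  by rewrite [RHS]big_ord_recr /= bin_small // mulr0 !mul0r addr0.
rewrite [X in _ = X - _]big_ord_recl /= !bin0 -addrA; congr (_ + _).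
rewrite mulr_sumr -sumrB; apply: eq_bigr => j _.
by rewrite /bump /= !add1n binS natrD !exprS; ring.
Qed.

(** For [i <= m] the sum is [C(m,i) (-y)^i (1-y)^(m-i)], up to sign a binomial probability. The
    induction avoids the closed form: Pascal's rule yields [(1 - y) u - y v] with [u] and [v]
    already bounded by 1. *)
Lemma altbin_bound i m y : 0 <= y <= 1 ->
  `|altbin (fun j => 'C(j, i)%:R) m y| <= 1.
Proof.
move=> /andP[y0 y1].
have le_conv (u v : R) : `|u| <= 1 -> `|v| <= 1 -> `|(1 - y) * u - y * v| <= 1.
  by rewrite !ler_norml => /andP[? ?] /andP[? ?]; apply/andP; split; nra.
elim: m i => [|m IH] i.
  rewrite /altbin big_ord1 !mul1r mulr1 normr_nat.
  by case: i => [|i]; rewrite ?bin0n.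
rewrite altbinS.
case: i => [|i].
  rewrite (_ : _ \o succn = fun j => 'C(j, 0)%:R); last first.
    by apply: funext => j /=; rewrite !bin0.
  rewrite -{1}[altbin _ _ _]mul1r -mulrBl -[X in `|X|]subr0 -[X in _ - X](mulr0 y).
  by apply: le_conv; rewrite ?normr0 ?IH.
rewrite (_ : altbin (_ \o _) m y =
   altbin (fun j => 'C(j, i.+1)%:R) m y + altbin (fun j => 'C(j, i)%:R) m y).
  rewrite (_ : _ - _ = (1 - y) * altbin (fun j => 'C(j, i.+1)%:R) m y
     - y * altbin (fun j => 'C(j, i)%:R) m y); last by ring.
  exact: le_conv.
rewrite /altbin -big_split; apply: eq_bigr => j _ /=.
by rewrite binS natrD; ring.
Qed.

(** Trading [i] for [i.+1] gains a factor [m.+1]; combined with [altbin_bound] this forces decay in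
    [m] for fixed [y > 0]. *)
Lemma altbin_diag i m y :
  i.+1%:R * altbin (fun j => 'C(j, i.+1)%:R) m.+1 y =
  - (m.+1%:R * y * altbin (fun j => 'C(j, i)%:R) m y).
Proof.
rewrite /altbin big_ord_recl bin0n mulr0 mul0r add0r !mulr_sumr -sumrN.
apply: eq_bigr => j _; rewrite lift0 !exprS.
have e1 : m.+1%:R * 'C(m, j)%:R = j.+1%:R * 'C(m.+1, j.+1)%:R :> R.
  by rewrite -!natrM -mul_bin_diag.
have e2 : j.+1%:R * 'C(j, i)%:R = i.+1%:R * 'C(j.+1, i.+1)%:R :> R.
  by rewrite -!natrM -mul_bin_diag.
set s := (-1) ^+ j; set Y := y ^+ j.
rewrite [RHS](_ : _ = - (s * y * Y * 'C(j, i)%:R * (m.+1%:R * 'C(m, j)%:R))); last by ring.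
rewrite e1 [LHS](_ : _ = - (s * y * Y * 'C(m.+1, j.+1)%:R *
  (i.+1%:R * 'C(j.+1, i.+1)%:R))); last by ring.
by rewrite -e2; ring.
Qed.

(** These are the two inputs of dominated convergence. The point [y = 0] is left out of the limit
    because [altbin e m 0] is always [e 0]. *)
Definition tame e : Prop :=
  (exists M, forall m y, 0 <= y <= 1 -> `|altbin e m y| <= M) /\
  (forall y, 0 < y <= 1 -> altbin e m y @[m --> \oo] --> (0 : R)).

Lemma tame_bin i : tame (fun j => 'C(j, i)%:R).
Proof.
split; first by exists 1 => m y; exact: altbin_bound.
move=> y /andP[y0 y1]; apply/cvgr0Pnorm_le => eps eps0.
(* The explicit majorant is [(i+1) / (y (m+1))]. *)
have h : (i.+1%:R / y) * harmonic m @[m --> \oo] --> (i.+1%:R / y * 0 : R).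
  by apply: cvgMr; exact: cvg_harmonic.
move: h; rewrite mulr0 => /cvgr0Pnorm_le/(_ _ eps0); apply: filterS => m /=.
apply: le_trans; rewrite [leRHS]ger0_norm; last first.
  by rewrite mulr_ge0 // ?divr_ge0 // ?ltW // ?invr_gt0.
rewrite /harmonic ler_pdivlMr ?ltr0n //  ler_pdivlMr //.
rewrite -[X in _ * X * _]normr_nat -[X in _ * X <= _](gtr0_norm y0) -!normrM.
rewrite (_ : _ * y = - (- (m.+1%:R * y * altbin (fun j => 'C(j, i)%:R) m y))); last by ring.
rewrite -altbin_diag normrN normrM normr_nat ler_piMr ?ler0n //.
by apply: altbin_bound; rewrite (ltW y0).
Qed.

Lemma altbin_lin c e e' m y :
  altbin (fun j => c * e j + e' j) m y = c * altbin e m y + altbin e' m y.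
Proof.
by rewrite /altbin mulr_sumr -big_split; apply: eq_bigr => j _ /=; ring.
Qed.

Lemma tame_lin c e e' : tame e -> tame e' -> tame (fun j => c * e j + e' j).
Proof.
move=> [[M HM] He] [[M' HM'] He']; split.
  exists (`|c| * M + M') => m y y01; rewrite altbin_lin (le_trans (ler_normD _ _)) //.
  by rewrite lerD ?HM' // normrM ler_wpM2l ?HM.
move=> y y01; under eq_fun do rewrite altbin_lin.
have -> : 0 = c * 0 + 0 :> R by rewrite mulr0 addr0.
by apply: cvgD; [apply: cvgMr; exact: He|exact: He'].
Qed.

Lemma tame_cubic a b c d :
  tame (fun j => a * j%:R ^+ 3 + b * j%:R ^+ 2 + c * j%:R + d).
Proof.
have C2 (j : nat) : 2 * 'C(j, 2)%:R = j%:R * (j%:R - 1) :> R.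
  elim: j => [|j IH]; first by rewrite bin0n mulr0 !mul0r.
  by rewrite binS bin1 natrD mulrDr IH -natr1; ring.
have C3 (j : nat) : 6 * 'C(j, 3)%:R = j%:R * (j%:R - 1) * (j%:R - 2) :> R.
  elim: j => [|j IH]; first by rewrite bin0n mulr0 !mul0r.
  rewrite binS natrD mulrDr IH (_ : 6 * 'C(j, 2)%:R = 3 * (2 * 'C(j, 2)%:R)); last by ring.
  by rewrite C2 -natr1; ring.
(* Expansion in the binomial basis; the constant [d] is split as [(d - 1) + 1] to end in the shape
   required by [tame_lin]. *)
rewrite (_ : (fun j => _) = fun j => (6 * a) * 'C(j, 3)%:R + ((6 * a + 2 * b) * 'C(j, 2)%:R +
  ((a + b + c) * 'C(j, 1)%:R + ((d - 1) * 'C(j, 0)%:R + 'C(j, 0)%:R)))).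
  by do 4 (apply: tame_lin; first exact: tame_bin); exact: tame_bin.
apply: funext => j; rewrite bin0 bin1.
rewrite (_ : 6 * a * 'C(j, 3)%:R = a * (6 * 'C(j, 3)%:R)); last by ring.
rewrite (_ : (6 * a + 2 * b) * 'C(j, 2)%:R = (3 * a + b) * (2 * 'C(j, 2)%:R)); last by ring.
by rewrite C2 C3; ring.
Qed.

Lemma altbin0 e m : altbin e m 0 = e 0%N.
Proof.
rewrite /altbin big_ord_recl big1 ?addr0 ?bin0; first by rewrite !mul1r mulr1.
by move=> j _; rewrite lift0 expr0n mulr0.
Qed.

End AlternatingBinomialSums.

(** * The test polynomials *)

Section TestFunctional.
Variables (R : realType) (t s : R).
Implicit Types mu nu : nat -> R.

Definition rec_form mu (k : nat) : R :=
  let n := k%:R + 1 in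
  (n + 3) * (t + n) * (t + n + 1) * mu k.+2 - s * (2 * n + 3) * (t + n) * mu k.+1
  - n * ((n + 1) ^+ 2 - (s ^+ 2 - 4 * t)) * mu k.

(* The recurrence tested against the polynomials (1 - x^2)^m. *)
Definition test_form m mu : R :=
  \sum_(j < m.+1) (-1) ^+ j * 'C(m, j)%:R * rec_form mu j.*2.

(** By linearity, [test_form m] of the moments of a measure is the integral of this polynomial. *)
Definition test_poly m (x : R) : R := test_form m (fun k => x ^+ k).

Lemma test_form_lin m c mu nu :
  test_form m (fun k => c * mu k + nu k) = c * test_form m mu + test_form m nu.
Proof.
rewrite /test_form mulr_sumr -big_split; apply: eq_bigr => j _ /=.
by rewrite /rec_form; ring.
Qed.

(** [e2], [e1] and [e0] are the coefficients of [rec_form] at [k = 2j], where [n = 2j + 1]; all are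
    polynomials in [j] of degree at most 3, hence tame. *)
Let e2 (j : nat) : R := (2 * j%:R + 4) * (t + 2 * j%:R + 1) * (t + 2 * j%:R + 2).
Let e1 (j : nat) : R := s * (4 * j%:R + 5) * (t + 2 * j%:R + 1).
Let e0 (j : nat) : R := (2 * j%:R + 1) * ((2 * j%:R + 2) ^+ 2 - (s ^+ 2 - 4 * t)).

Let tame2 : tame e2.
Proof.
have := tame_cubic 8 (8 * t + 28) (2 * t ^+ 2 + 22 * t + 28) (4 * (t + 1) * (t + 2)).
by congr tame; apply: funext => j; rewrite /e2; ring.
Qed.

Let tame1 : tame e1.
Proof.
have := tame_cubic 0 (8 * s) (s * (4 * t + 14)) (5 * s * (t + 1)).
by congr tame; apply: funext => j; rewrite /e1; ring.
Qed.

Let tame0 : tame e0.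
Proof.
have := tame_cubic 8 20 (16 - 2 * (s ^+ 2 - 4 * t)) (4 - (s ^+ 2 - 4 * t)).
by congr tame; apply: funext => j; rewrite /e0; ring.
Qed.

Let test_polyE m x : test_poly m x = x ^+ 2 * altbin e2 m (x ^+ 2)
  + (- x * altbin e1 m (x ^+ 2) - altbin e0 m (x ^+ 2)).
Proof.
rewrite /test_poly /test_form /altbin !mulr_sumr -!sumrB -big_split.
apply: eq_bigr => j _ /=; rewrite /rec_form /e2 /e1 /e0 -exprM mulnC muln2 !exprS.
by rewrite -muln2 natrM; ring.
Qed.

Lemma test_poly0 m : test_poly m 0 = - (4 - (s ^+ 2 - 4 * t)).
Proof. by rewrite test_polyE expr0n /= !altbin0 /e0; ring. Qed.

Lemma test_poly_bounded : exists M, forall m x, `|x| <= 1 -> `|test_poly m x| <= M.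
Proof.
have [[M2 H2] _] := tame2; have [[M1 H1] _] := tame1; have [[M0 H0] _] := tame0.
exists (M2 + (M1 + M0)) => m x x1.
have x2 : 0 <= x ^+ 2 <= 1 by rewrite sqr_ge0 -real_normK ?num_real // expr_le1.
have h2 := H2 m _ x2; have h1 := H1 m _ x2; have h0 := H0 m _ x2.
rewrite test_polyE (le_trans (ler_normD _ _)) // lerD //.
  rewrite normrM (le_trans _ h2) // ler_piMl // ger0_norm ?sqr_ge0 //.
  by case/andP: x2.
rewrite (le_trans (ler_normB _ _)) // lerD // normrM normrN (le_trans _ h1) //.
by rewrite ler_piMl.
Qed.

Lemma test_poly_cvg0 x : x != 0 -> `|x| <= 1 -> test_poly m x @[m --> \oo] --> (0 : R).
Proof.
move=> x0 x1; under eq_fun do rewrite test_polyE.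
have x2 : 0 < x ^+ 2 <= 1.
  by rewrite exprn_even_gt0 //= x0 -real_normK ?num_real // expr_le1.
have -> : 0 = x ^+ 2 * 0 + (- x * 0 - 0) :> R by ring.
apply: cvgD; last apply: cvgB.
- by apply: cvgMr; case: tame2 => _; apply.
- by apply: cvgMr; case: tame1 => _; apply.
- by case: tame0 => _; apply.
Qed.

End TestFunctional.

(** * Interchange of limits and sums *)

Lemma cvgn_sum (R : realType) N (f : nat -> nat -> R) (l : nat -> R) :
  (forall i, f i n @[n --> \oo] --> l i) ->
  \sum_(i < N) f i n @[n --> \oo] --> \sum_(i < N) l i.
Proof.
move=> fl; elim: N => [|N IH].
  by under eq_fun do rewrite big_ord0; rewrite big_ord0; exact: cvg_cst.
by under eq_fun do rewrite big_ord_recr; rewrite big_ord_recr; exact: cvgD.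
Qed.

(** Dominated convergence for series: the head is a finite sum tending to 0, and the tail is
    controlled by the majorant [b]. *)
Lemma tannery (R : realType) (F : nat -> nat -> R) (b G : nat -> R) (l : R) :
  (forall m i, `|F m i| <= b i) ->
  \sum_(i < n) b i @[n --> \oo] --> l ->
  (forall i, F m i @[m --> \oo] --> (0 : R)) ->
  (forall m, \sum_(i < n) F m i @[n --> \oo] --> G m) ->
  G m @[m --> \oo] --> (0 : R).
Proof.
move=> Fb bl F0 FG.
have b0 i : 0 <= b i by apply: le_trans (Fb 0%N i).
have bnd : nondecreasing_seq (fun n => \sum_(i < n) b i).
  by apply/nondecreasing_seqP => n; rewrite big_ord_recr /= lerDl.
have ble n : \sum_(i < n) b i <= l.
  rewrite -(cvg_lim _ bl) //; apply: nondecreasing_cvgn_le => //; apply/cvg_ex; by exists l.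
apply/cvgr0Pnorm_le => e e0.
have e20 : 0 < e / 2 by rewrite divr_gt0.
have [N _ HN] : \forall n \near \oo, `|l - \sum_(i < n) b i| <= e / 2.
  by move/cvgrPdist_le : bl; exact.
have {HN} := HN N (leqnn N); rewrite ger0_norm ?subr_ge0 // => HN.
have FN0 : \sum_(i < N) `|F m i| @[m --> \oo] --> (0 : R).
  have := @cvgn_sum _ N (fun i m => `|F m i|) (fun=> 0); rewrite big1 //; apply=> i.
  by rewrite -(normr0 R); apply: cvg_norm; exact: F0.
move/cvgr0Pnorm_le : FN0 => /(_ _ e20); apply: filterS => m /=.
rewrite ger0_norm ?sumr_ge0 // => mN.
have FGn : `|\sum_(i < n) F m i| @[n --> \oo] --> `|G m| by apply: cvg_norm; exact: FG.
apply: (cvgr_to_le FGn); exists N => // n /= Nn.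
rewrite (le_trans (ler_norm_sum _ _ _)) //.
rewrite -(big_mkord xpredT (fun i => `|F m i|)) (big_cat_nat (leq0n N) Nn) //= big_mkord.
rewrite [leRHS]splitr lerD // (le_trans (ler_sum _ (fun i _ => Fb m i))) //.
rewrite (le_trans _ HN) // lerBrDr addrC -(big_mkord xpredT b) -big_cat_nat //=.
by rewrite big_mkord.
Qed.

(** * Moments of the Thoma measure of a point *)

Section ThomaPoint.
Variables (R : realType) (w : Thoma R).

Lemma thomaP : [/\ forall i, 0 <= alpha w i, forall i, 0 <= beta w i, 0 <= gamma w &
  \sum_(i < n) (alpha w i + beta w i) @[n --> \oo] --> 1 - gamma w].
Proof.
by rewrite /alpha /beta /gamma; case: w => [[[a b] g] /= [a0 [_ [b0 [_ [g0 h]]]]]]; split.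
Qed.

Let a0 i : 0 <= alpha w i. Proof. by have [] := thomaP. Qed.
Let b0 i : 0 <= beta w i. Proof. by have [] := thomaP. Qed.
Lemma gamma_ge0 : 0 <= gamma w. Proof. by have [] := thomaP. Qed.

Lemma thoma_sum_le n : \sum_(i < n) (alpha w i + beta w i) <= 1 - gamma w.
Proof.
have [_ _ _ h] := thomaP.
rewrite -(cvg_lim _ h) //; apply: nondecreasing_cvgn_le; last by apply/cvg_ex; eexists; exact: h.
by apply/nondecreasing_seqP => m; rewrite big_ord_recr /= lerDl addr_ge0.
Qed.

Let ab1 i : alpha w i + beta w i <= 1.
Proof.
apply: (@le_trans _ _ (\sum_(j < i.+1) (alpha w j + beta w j))).
  by rewrite big_ord_recr /= lerDr sumr_ge0 // => j _; rewrite addr_ge0.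
by apply: le_trans (thoma_sum_le _) _; rewrite gerBl gamma_ge0.
Qed.

Lemma alpha_norm_le1 i : `|alpha w i| <= 1.
Proof. by rewrite ger0_norm // (le_trans _ (ab1 i)) // lerDl. Qed.

Lemma beta_norm_le1 i : `|- beta w i| <= 1.
Proof. by rewrite normrN ger0_norm // (le_trans _ (ab1 i)) // lerDr. Qed.

(** [rsum] is a [limn], so convergence has to be shown; the partial sums are monotone and bounded by
    [1 - gamma w]. *)
Let rsum_cvg (u : nat -> R) : (forall i, 0 <= u i <= alpha w i + beta w i) ->
  \sum_(i < n) u i @[n --> \oo] --> rsum u.
Proof.
move=> uab; apply: nondecreasing_is_cvgn.
  by apply/nondecreasing_seqP => m; rewrite big_ord_recr /= lerDl; case/andP: (uab m).
exists (1 - gamma w) => _ [n _ <-]; apply: le_trans (thoma_sum_le n).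
by apply: ler_sum => i _; case/andP: (uab i).
Qed.

(* [ptilde w k.+1] is the k-th moment of the Thoma measure of [w]. *)
Lemma ptilde_cvg k :
  gamma w * 0 ^+ k + \sum_(i < n) (alpha w i * alpha w i ^+ k + beta w i * (- beta w i) ^+ k)
  @[n --> \oo] --> ptilde w k.+1.
Proof.
case: k => [|k].
  (* The convention [ptilde w 1 = 1] is the total mass; [gamma] enters only here, through
     [0 ^+ 0 = 1]. *)
  under eq_fun do under eq_bigr do rewrite !expr0 !mulr1.
  rewrite expr0 mulr1 /ptilde /= (_ : 1 = gamma w + (1 - gamma w)); last by ring.
  by have [_ _ _ h] := thomaP; apply: cvgD => //; exact: cvg_cst.
rewrite /ptilde /= expr0n mulr0.
have le_pow (x : R) : 0 <= x -> x <= 1 -> 0 <= x ^+ k.+2 <= x.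
  by move=> x0 x1; rewrite exprn_ge0 //= exprS ler_piMr // exprn_ile1.
have a1 i := alpha_norm_le1 i; have b1 i := beta_norm_le1 i.
have ha : \sum_(i < n) alpha w i ^+ k.+2 @[n --> \oo] --> rsum (fun i => alpha w i ^+ k.+2).
  apply: rsum_cvg => i; have /andP[-> h] : 0 <= alpha w i ^+ k.+2 <= alpha w i.
    by apply: le_pow; rewrite // -[leLHS]ger0_norm.
  by rewrite (le_trans h) // lerDl.
have hb : \sum_(i < n) beta w i ^+ k.+2 @[n --> \oo] --> rsum (fun i => beta w i ^+ k.+2).
  apply: rsum_cvg => i; have /andP[-> h] : 0 <= beta w i ^+ k.+2 <= beta w i.
    by apply: le_pow; rewrite // -[leLHS]ger0_norm // -normrN.
  by rewrite (le_trans h) // lerDr.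
under eq_fun.
  move=> n; rewrite add0r big_split /=.
  rewrite (eq_bigr (fun i : 'I_n => alpha w i ^+ k.+2)); last by move=> i _; rewrite -exprS.
  rewrite [X in _ + X](_ : _ = (-1) ^+ k.+1 * \sum_(i < n) beta w i ^+ k.+2).
    over.
  by rewrite mulr_sumr; apply: eq_bigr => i _; rewrite [in LHS]exprNn mulrCA -exprS.
by apply: cvgD => //; apply: cvgMr.
Qed.

(** For finitely many atoms this is linearity, by induction on their number; [test_form] involves
    finitely many moments, so the limit passes through. *)
Lemma test_form_ptilde_cvg (t s : R) m :
  gamma w * test_poly t s m 0 + \sum_(i < n) (alpha w i * test_poly t s m (alpha w i)
    + beta w i * test_poly t s m (- beta w i))
  @[n --> \oo] --> test_form t s m (fun k => ptilde w k.+1).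
Proof.
have E n : gamma w * test_poly t s m 0 + \sum_(i < n) (alpha w i * test_poly t s m (alpha w i)
    + beta w i * test_poly t s m (- beta w i)) =
  test_form t s m (fun k => gamma w * 0 ^+ k +
    \sum_(i < n) (alpha w i * alpha w i ^+ k + beta w i * (- beta w i) ^+ k)).
  elim: n => [|n IH].
    (* The coefficient [gamma w] is split so as to fit [test_form_lin]. *)
    rewrite big_ord0 (_ : (fun k => _) = fun k => (gamma w - 1) * 0 ^+ k + 0 ^+ k).
      by rewrite test_form_lin /test_poly; ring.
    by apply: funext => k; rewrite big_ord0; ring.
  rewrite big_ord_recr /= addrA IH (_ : (fun k => gamma w * 0 ^+ k + \sum_(i < n.+1) _) =
    fun k => alpha w n * alpha w n ^+ k + (beta w n * (- beta w n) ^+ k + (gamma w * 0 ^+ k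
      + \sum_(i < n) (alpha w i * alpha w i ^+ k + beta w i * (- beta w i) ^+ k)))).
    by rewrite !test_form_lin /test_poly; ring.
  by apply: funext => k; rewrite big_ord_recr /=; ring.
under eq_fun do rewrite E.
rewrite /test_form; apply: (@cvgn_sum _ m.+1 (fun j n => (-1) ^+ j * 'C(m, j)%:R * rec_form t s (fun k =>
    gamma w * 0 ^+ k + \sum_(i < n) (alpha w i * alpha w i ^+ k + beta w i * (- beta w i) ^+ k))
    j.*2) (fun j => (-1) ^+ j * 'C(m, j)%:R * rec_form t s (fun k => ptilde w k.+1) j.*2)) => j.
apply: cvgMr; rewrite /rec_form.
by apply: cvgB; [apply: cvgB|]; apply: cvgMr; exact: ptilde_cvg.
Qed.

End ThomaPoint.

Lemma cvgn_norm_le (R : realType) (u : nat -> R) (l M : R) :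
  u n @[n --> \oo] --> l -> (forall n, `|u n| <= M) -> `|l| <= M.
Proof.
move=> ul uM; have h : `|u n| @[n --> \oo] --> `|l| by apply: cvg_norm.
by apply: (cvgr_to_le h); exact: nearW.
Qed.

Lemma thoma_sum_norm (R : realType) (w : Thoma R) (f : R -> R) M i :
  (forall x, `|x| <= 1 -> `|f x| <= M) ->
  `|alpha w i * f (alpha w i) + beta w i * f (- beta w i)| <= M * (alpha w i + beta w i).
Proof.
move=> fM; have [a0 b0 _ _] := thomaP w.
rewrite (le_trans (ler_normD _ _)) // mulrDr !normrM !(ger0_norm (a0 i), ger0_norm (b0 i)).
by rewrite ![M * _]mulrC lerD // ler_wpM2l ?fM ?alpha_norm_le1 ?beta_norm_le1.
Qed.

(** The Thoma measure is a probability measure on [[-1, 1]], so it inherits the uniform bound on the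
    test polynomials. *)
Lemma test_form_ptilde_bounded (R : realType) (t s : R) :
  exists M, forall m (w : Thoma R), `|test_form t s m (fun k => ptilde w k.+1)| <= M.
Proof.
have [M HM] := test_poly_bounded t s; exists M => m w.
have [a0 b0 g0 _] := thomaP w.
have M0 : 0 <= M by apply: le_trans (HM 0%N 0 _); rewrite ?normr0.
apply: (cvgn_norm_le (@test_form_ptilde_cvg R w t s m)) => n; rewrite (le_trans (ler_normD _ _)) //.
rewrite (_ : M = M * gamma w + M * (1 - gamma w)) ?lerD //; last by ring.
  by rewrite normrM ger0_norm // mulrC ler_wpM2r // HM // normr0.
rewrite (le_trans (ler_norm_sum _ _ _)) // (le_trans _ (ler_wpM2l M0 (thoma_sum_le w n))) //.
by rewrite mulr_sumr; apply: ler_sum => i _; apply: thoma_sum_norm => x; exact: HM.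
Qed.

(** All atoms off [0] disappear by [tannery], leaving the mass [gamma w] times the constant value at
    [0]. *)
Lemma test_form_ptilde_lim (R : realType) (t s : R) (w : Thoma R) :
  test_form t s m (fun k => ptilde w k.+1) @[m --> \oo] -->
  - (4 - (s ^+ 2 - 4 * t)) * gamma w.
Proof.
have [M HM] := test_poly_bounded t s.
have [a0 b0 g0 h] := thomaP w.
pose F m i := alpha w i * test_poly t s m (alpha w i) + beta w i * test_poly t s m (- beta w i).
have F0 : (test_form t s m (fun k => ptilde w k.+1) - gamma w * test_poly t s m 0)
    @[m --> \oo] --> (0 : R).
  apply: (@tannery _ F (fun i => M * (alpha w i + beta w i)) _ (M * (1 - gamma w))).
  - by move=> m i; apply: thoma_sum_norm => x; exact: HM.
  - by under eq_fun do rewrite -mulr_sumr; apply: cvgMr.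
  - move=> i; rewrite (_ : 0 = alpha w i * 0 + beta w i * 0); last by rewrite !mulr0 addr0.
    (* If [alpha_i] or [beta_i] is 0, its atom lies at [0], where the test polynomials do not tend
       to 0; but then its weight is 0. *)
    have aux (c x : R) : (c != 0 -> x != 0) -> `|x| <= 1 ->
        c * test_poly t s m x @[m --> \oo] --> c * 0.
      move=> cx x1; have [->|c0] := eqVneq c 0.
        by under eq_fun do rewrite mul0r; rewrite mul0r; exact: cvg_cst.
      by apply: cvgMr; apply: test_poly_cvg0; rewrite ?cx.
    by apply: cvgD; apply: aux; rewrite ?oppr_eq0 ?alpha_norm_le1 ?beta_norm_le1.
  - move=> m; have E n : \sum_(i < n) F m i = gamma w * test_poly t s m 0 +
        \sum_(i < n) F m i - gamma w * test_poly t s m 0 by rewrite addrAC subrr add0r.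
    under eq_fun do rewrite E.
    by apply: cvgB; [exact: test_form_ptilde_cvg|exact: cvg_cst].
have -> : - (4 - (s ^+ 2 - 4 * t)) * gamma w = 0 + gamma w * - (4 - (s ^+ 2 - 4 * t)) by ring.
have E m : test_form t s m (fun k => ptilde w k.+1) =
    test_form t s m (fun k => ptilde w k.+1) - gamma w * test_poly t s m 0
    + gamma w * - (4 - (s ^+ 2 - 4 * t)) by rewrite test_poly0 subrK.
under eq_fun do rewrite E.
by apply: cvgD => //; exact: cvg_cst.
Qed.

(** * Bounded measurable functions on the Thoma simplex *)

Section BoundedMeasurable.
Variables (R : realType).

Definition bmeas (f : ThomaM R -> R) : Prop :=
  measurable_fun [set: ThomaM R] f /\ exists M, forall w, `|f w| <= M.

Lemma bmeas_cst c : bmeas (fun=> c).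
Proof. by split; [exact: measurable_cst|exists `|c|]. Qed.

Lemma bmeasD f g : bmeas f -> bmeas g -> bmeas (fun w => f w + g w).
Proof.
move=> [mf [M fM]] [mg [N gN]]; split; first exact: measurable_funD.
by exists (M + N) => w; rewrite (le_trans (ler_normD _ _)) // lerD.
Qed.

Lemma bmeasM f g : bmeas f -> bmeas g -> bmeas (fun w => f w * g w).
Proof.
move=> [mf [M fM]] [mg [N gN]]; split; first exact: measurable_funM.
by exists (M * N) => w; rewrite normrM ler_pM.
Qed.

Lemma bmeas_sum (I : Type) (r : seq I) (f : I -> ThomaM R -> R) :
  (forall i, bmeas (f i)) -> bmeas (fun w => \sum_(i <- r) f i w).
Proof.
move=> fb; elim: r => [|i r IH].
  by under eq_fun do rewrite big_nil; exact: bmeas_cst.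
by under eq_fun do rewrite big_cons; exact: bmeasD.
Qed.

Lemma bmeas_prod (I : Type) (r : seq I) (f : I -> ThomaM R -> R) :
  (forall i, bmeas (f i)) -> bmeas (fun w => \prod_(i <- r) f i w).
Proof.
move=> fb; elim: r => [|i r IH].
  by under eq_fun do rewrite big_nil; exact: bmeas_cst.
by under eq_fun do rewrite big_cons; exact: bmeasM.
Qed.

Lemma bmeas_integrable (P : probability (ThomaM R) R) f :
  bmeas f -> P.-integrable [set: ThomaM R] (EFin \o f).
Proof.
move=> [mf [M fM]]; apply: measurable_bounded_integrable => //.
  by rewrite [X in (X < _)%E](probability_setT P) ltry.
exists M; split; first exact: num_real.
by move=> x Mx w _; apply: le_trans (fM w) _; exact: ltW.
Qed.

Lemma measurable_alpha i : measurable_fun [set: ThomaM R] (fun w : ThomaM R => alpha w i).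
Proof.
move=> _ B mB; rewrite setTI; apply: sub_sigma_algebra; exists i, B; split => //; by left.
Qed.

Lemma measurable_beta i : measurable_fun [set: ThomaM R] (fun w : ThomaM R => beta w i).
Proof.
move=> _ B mB; rewrite setTI; apply: sub_sigma_algebra; exists i, B; split => //; by right.
Qed.

(** [gamma] is not among the generating coordinates; it is recovered as a limit of functions of the
    [alpha_i] and [beta_i]. *)
Lemma measurable_gamma : measurable_fun [set: ThomaM R] (@gamma R : ThomaM R -> R).
Proof.
apply: (@measurable_fun_cvg _ _ _ _ (fun n (w : ThomaM R) => 1 - \sum_(i < n) (alpha w i + beta w i))).
  move=> n; apply: measurable_funB; first exact: measurable_cst.
  apply: measurable_sum => i; apply: measurable_funD.
    exact: measurable_alpha.
  exact: measurable_beta.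
move=> w _; have [_ _ _ h] := thomaP w.
rewrite -[X in _ --> X](subKr 1).
by apply: cvgB => //; exact: cvg_cst.
Qed.

Lemma bmeas_gamma : bmeas (@gamma R).
Proof.
split; first exact: measurable_gamma.
exists 1 => w; have [_ _ g0 _] := thomaP w.
by rewrite ger0_norm // -subr_ge0 (le_trans _ (thoma_sum_le w 0)) // big_ord0.
Qed.

Lemma bmeas_ptilde k : bmeas (fun w => ptilde w k.+1).
Proof.
pose h n (w : ThomaM R) := gamma w * 0 ^+ k +
  \sum_(i < n) (alpha w i * alpha w i ^+ k + beta w i * (- beta w i) ^+ k).
split.
  apply: (@measurable_fun_cvg _ _ _ _ h); last by move=> w _; exact: ptilde_cvg.
  move=> n; apply: measurable_funD.
    by apply: measurable_funM; [exact: measurable_gamma|exact: measurable_cst].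
  apply: measurable_sum => i.
  have ma := measurable_alpha i; have mb := measurable_beta i.
  apply: measurable_funD; apply: measurable_funM => //; apply: measurable_funX => //.
  exact: measurableT_comp.
exists 1 => w; have [a0 b0 g0 _] := thomaP w.
apply: (cvgn_norm_le (@ptilde_cvg R w k)) => n; rewrite (le_trans (ler_normD _ _)) //.
have x1 (x : R) : `|x| <= 1 -> `|x ^+ k| <= 1 by move=> ?; rewrite normrX exprn_ile1.
rewrite -[leRHS](subrKC (gamma w)) lerD //.
  by rewrite normrM ger0_norm // ler_piMr // x1 // normr0.
rewrite (le_trans (ler_norm_sum _ _ _)) // (le_trans _ (thoma_sum_le w n)) //.
apply: ler_sum => i _; rewrite -[leRHS]mul1r.
by apply: (@thoma_sum_norm _ _ (fun x => x ^+ k)) => x; exact: x1.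
Qed.

Lemma bmeas_hpow n : bmeas (fun w => hpow (ptilde w) n).
Proof.
elim/ltn_ind: n => -[|n] IH; first exact: bmeas_cst.
rewrite (_ : (fun w => _) = fun w => n.+1%:R^-1 * \sum_(k < n.+1) ptilde w k.+1 * hpow (ptilde w) (n - k)%N).
  apply: bmeasM; first exact: bmeas_cst.
  apply: bmeas_sum => k; apply: bmeasM; first exact: bmeas_ptilde.
  by apply: IH; rewrite ltnS leq_subr.
by apply: funext => w; rewrite -hpow_newton mulKf // pnatr_eq0.
Qed.

Lemma bmeas_stilde lam : bmeas (@stilde R lam).
Proof.
rewrite /stilde /determinant; apply: bmeas_sum => s.
apply: bmeasM; first exact: bmeas_cst.
apply: bmeas_prod => i; under eq_fun do rewrite mxE.
case: (_ + _)%Z => n; [exact: bmeas_hpow|exact: bmeas_cst].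
Qed.

End BoundedMeasurable.

(** * Integration over the Thoma simplex *)

Section Expectation.
Variables (R : realType) (P : probability (ThomaM R) R).

Local Notation E := (Rintegral P setT).

Lemma integral_bmeas f : bmeas f -> (\int[P]_w (f w)%:E)%E = (E f)%:E.
Proof.
move=> /bmeas_integrable fi; rewrite /Rintegral fineK //.
exact: (integrable_fin_num measurableT (fi P)).
Qed.

Let E_lin c f g : bmeas f -> bmeas g -> E (fun w => c * f w + g w) = c * E f + E g.
Proof.
move=> bf bg; have ic := bmeas_integrable P (bmeasM (bmeas_cst c) bf).
rewrite RintegralD //; last exact: bmeas_integrable.
by rewrite RintegralZl //; exact: bmeas_integrable.
Qed.

Let E_sum n (c : nat -> R) (f : nat -> ThomaM R -> R) : (forall i, bmeas (f i)) ->
  E (fun w => \sum_(i < n) c i * f i w) = \sum_(i < n) c i * E (f i).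
Proof.
move=> bf; elim: n => [|n IH].
  (* The integral of 0 is found from linearity, as [- E 0 + E 0]. *)
  rewrite big_ord0 -[RHS](addNr (E (fun=> 0))) -mulN1r -E_lin; try exact: bmeas_cst.
  by congr (E _); apply: funext => w; rewrite big_ord0 mulr0 addr0.
rewrite big_ord_recr /= [RHS]addrC -IH -E_lin //.
  by congr (E _); apply: funext => w; rewrite big_ord_recr /= addrC.
by apply: bmeas_sum => i; apply: bmeasM => //; exact: bmeas_cst.
Qed.

Definition ptilde_moment n : R := E (fun w => ptilde w n.+1).

Let bmeas_rec_form (t s : R) k : bmeas (fun w => rec_form t s (fun i => ptilde w i.+1) k).
Proof.
rewrite /rec_form.
have b c i : bmeas (fun w : ThomaM R => c * ptilde w i.+1).
  by apply: bmeasM; [exact: bmeas_cst|exact: bmeas_ptilde].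
have bN f : bmeas f -> bmeas (fun w : ThomaM R => - f w).
  move=> bf; rewrite (_ : (fun w => _) = fun w => -1 * f w); last first.
    by apply: funext => w; rewrite mulN1r.
  by apply: bmeasM => //; exact: bmeas_cst.
by apply: bmeasD; [apply: bmeasD => //|]; exact: bN.
Qed.

Lemma bmeas_test_form (t s : R) m :
  bmeas (fun w => test_form t s m (fun k => ptilde w k.+1)).
Proof. by apply: bmeas_sum => j; apply: bmeasM => //; exact: bmeas_cst. Qed.

Lemma Rintegral_test_form (t s : R) m :
  E (fun w => test_form t s m (fun k => ptilde w k.+1)) = test_form t s m ptilde_moment.
Proof.
rewrite /test_form (@E_sum m.+1 (fun j => (-1) ^+ j * 'C(m, j)%:R)
  (fun j w => rec_form t s (fun k => ptilde w k.+1) j.*2)) //.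
apply: eq_bigr => j _; congr (_ * _); rewrite /rec_form /=.
set n : R := _ + 1; set a := (_ * (t + n + 1)); set b := (_ * (t + n)); set c := (n * _).
have bp := @bmeas_ptilde R.
rewrite (_ : (fun w => _) = fun w => a * ptilde w (j.*2).+3 + (- b * ptilde w (j.*2).+2 +
    (- c * ptilde w (j.*2).+1 + 0))); last by apply: funext => w; ring.
have b3 : bmeas (fun w : ThomaM R => - c * ptilde w (j.*2).+1 + 0).
  by apply: bmeasD; [apply: bmeasM => //|]; exact: bmeas_cst.
rewrite E_lin //; last by apply: bmeasD => //; apply: bmeasM => //; exact: bmeas_cst.
rewrite E_lin // E_lin //; last exact: bmeas_cst.
rewrite (_ : E (fun=> 0) = 0); last by rewrite /Rintegral integral0_eq.
by rewrite /ptilde_moment; ring.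
Qed.

(** Integrating [sum_stilde_hooks] leaves only hook shapes, where the defining property of [P]
    applies. *)
Lemma ptilde_momentE (z z' : R[i]) n :
  (forall lam : seq nat, is_partition lam ->
     Mz z z' lam / (dimY lam)%:R = real_complex R (E (stilde lam))) ->
  (ptilde_moment n)%:C%C = hook_moment z z' n.
Proof.
move=> hM; rewrite /hook_moment -hook_sum_Mz.
have -> : ptilde_moment n = \sum_(k < n.+1) (-1) ^+ k * E (stilde (hook (n - k) k)).
  rewrite -(@E_sum n.+1 (fun k => (-1) ^+ k) (fun k => stilde (hook (n - k) k))).
    by congr (E _); apply: funext => w; rewrite sum_stilde_hooks.
  by move=> i; exact: bmeas_stilde.
rewrite rmorph_sum; apply: eq_bigr => k _.
by rewrite rmorphM rmorphXn rmorphN1 hM //; exact: hook_partition.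
Qed.

(** Every test integral is 0 by the recurrence, while by dominated convergence they tend to [- c]
    times the integral of [gamma], with [c > 0]. *)
Lemma integral_gamma_eq0 (t s : R) : 0 < 4 - (s ^+ 2 - 4 * t) ->
  (forall k, rec_form t s ptilde_moment k = 0) ->
  (\int[P]_w (gamma w)%:E = 0)%E.
Proof.
move=> ts rec0; set c := 4 - _ in ts.
have [M HM] := test_form_ptilde_bounded t s.
have bg : bmeas (fun w : ThomaM R => - c * gamma w).
  by apply: bmeasM; [exact: bmeas_cst|exact: bmeas_gamma].
have bt := bmeas_test_form t s.
have [] := @dominated_convergence _ _ _ P setT measurableT
  (fun m w => (test_form t s m (fun k => ptilde w k.+1))%:E)
  (fun w => (- c * gamma w)%:E) (EFin \o cst M).
- by move=> m; apply/measurable_EFinP; case: (bt m).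
- by apply/measurable_EFinP; case: bg.
- apply: aeW => w _; apply: cvg_EFin; first exact: nearW.
  exact: test_form_ptilde_lim.
- exact: finite_measure_integrable_cst.
- by apply: aeW => w m _ /=; rewrite lee_fin HM.
have T0 m : test_form t s m ptilde_moment = 0.
  by rewrite /test_form big1 // => j _; rewrite rec0 mulr0.
move=> _ _; under eq_fun do rewrite integral_bmeas // Rintegral_test_form T0.
rewrite (integral_bmeas bg) => h.
have : (E (fun w => - c * gamma w))%:E = 0%E.
  by rewrite -(cvg_lim _ h) // lim_cst.
move=> [] /eqP; rewrite RintegralZl //; last by apply: bmeas_integrable; exact: bmeas_gamma.
rewrite mulf_eq0 oppr_eq0 gt_eqF //= => /eqP Eg.
by rewrite integral_bmeas ?Eg //; exact: bmeas_gamma.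
Qed.

(** * The atom at zero and the face where gamma vanishes *)

(** Atoms with [alpha_i = 0] or [beta_i = 0] also sit at [0], but they carry no weight. *)
Lemma nu_omega0 (w : ThomaM R) : nu_omega w [set 0] = gamma w.
Proof.
have mul_ind0 (x : R) : x * \1_([set 0] : set R) x = 0.
  by rewrite indicE; have [->|x0] := eqVneq x 0; rewrite ?mul0r // memNset ?mulr0 //= => /eqP; rewrite (negPf x0).
have rsum0 (u : nat -> R) : (forall i, u i = 0) -> rsum u = 0.
  move=> u0; rewrite /rsum; under eq_fun do rewrite big1 //.
  exact: lim_cst.
rewrite /nu_omega rsum0 => [|i]; last exact: mul_ind0.
rewrite rsum0 => [|i]; last first.
  by have := mul_ind0 (- beta w i); rewrite mulNr => /eqP; rewrite oppr_eq0 => /eqP.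
by rewrite !add0r indicE mem_set // mulr1.
Qed.

(** A nonnegative function with zero integral vanishes almost everywhere. *)
Lemma prob_gamma_eq0 : (\int[P]_w (gamma w)%:E = 0)%E -> P (@Omega0 R) = 1%E.
Proof.
move=> g0.
have mg : measurable_fun [set: ThomaM R] (EFin \o @gamma R).
  by apply/measurable_EFinP; exact: measurable_gamma.
have mO : measurable (@Omega0 R).
  have := @measurable_gamma R measurableT [set 0] (measurable_set1 0).
  by rewrite setTI.
have /(ae_eq_integral_abs P measurableT mg) [N [mN PN sN]] :
    (\int[P]_(w in setT) `|(EFin \o @gamma R) w| = 0)%E.
  by rewrite -[RHS]g0; apply: eq_integral => w _; rewrite /= ger0_norm // gamma_ge0.
have PC : P (~` @Omega0 R) = 0%E.
  apply: (subset_measure0 _ mN _ PN); first exact: measurableC.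
  by move=> w /= w0; apply: sN => /= h; apply: w0; have [] := h I.
by have := probability_setC P (measurableC mO); rewrite setCK PC sube0.
Qed.

End Expectation.

Theorem theorem6p1 (R : realType) (z z' : R[i]) (P : probability (ThomaM R) R) :
  admissible z z' ->
  (* P is the spectral z-measure P_{zz'}: M_{zz'}(lam)/dim lam = int s~_lam dP *)
  (forall lam : seq nat, is_partition lam ->
     Mz z z' lam / (dimY lam)%:R = real_complex R (\int[P]_(w in setT) stilde lam w)) ->
  P (@Omega0 R) = 1%E /\ sigma1 P [set 0] = 0%E.
Proof.
move=> /admissible_real[t [s [t0 ts zz' zDz']]] hM.
have g0 : (\int[P]_w (gamma w)%:E = 0)%E.
  (* The moment recurrence holds in [R[i]]; injectivity of the embedding brings it back to [R]. *)
  apply: (@integral_gamma_eq0 _ _ t s ts) => k; apply: complexI.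
  (* Positivity of [t] keeps every Pochhammer denominator nonzero. *)
  have zi (i : nat) : z * z' + i%:R != 0.
    rewrite zz' -(rmorph_nat (real_complex R)) -rmorphD fmorph_eq0.
    by rewrite gt_eqF // ltr_pwDl.
  have := hook_moment_rec k zi.
  rewrite zz' zDz' -!(ptilde_momentE _ hM) rmorph0 => <-; rewrite /rec_form.
  by rewrite !(rmorphB, rmorphM, rmorphD, rmorphXn, rmorph_nat, rmorph1).
split; first exact: prob_gamma_eq0.
by rewrite -[RHS]g0; apply: eq_integral => w _; rewrite nu_omega0.
Qed.
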